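(* Let $F$ be a scalar group, let $V$ be a near-vector space over $F$, and let $v \in V \setminus \{0\}$. Then there is $\Theta \subseteq Q(V)$ with $|\Theta| = \dim(v)$ such that $v = \sum_{q \in \Theta} q$ and $$\operatorname{Span}(v) = \operatorname{Span}(\Theta) = \bigoplus_{q \in \Theta} F\cdot q.$$
   Context: A scalar group is a tuple $F=(F,\cdot,1,0,-1)$ where $(F,\cdot,1)$ is a monoid, $0,-1\in F$, $0\cdot\alpha=0=\alpha\cdot 0$ for all $\alpha\in F$, $\{1,-1\}$ is the solution set of the equation $x^2=1$ in $F$, and $(F\setminus\{0\},\cdot,1)$ is a group. Write $-\alpha := (-1)\cdot\alpha$. An $F$-space is an abelian group $(V,+)$ with a map $F\times V\to V$, $(\alpha,v)\mapsto\alpha\cdot v$, such that for all $\alpha,\beta\in F$, $v,w\in V$: $\alpha\cdot(\beta\cdot v)=(\alpha\cdot\beta)\cdot v$, $1\cdot v=v$, $\alpha\cdot(v+w)=\alpha\cdot v+\alpha\cdot w$, $(-1)\cdot v=-v$, $0\cdot v=0$. The quasi-kernel of $V$ is $Q(V)=\{v\in V\mid \forall \alpha,\beta\in F\ \exists\gamma\in F:\ \alpha\cdot v+\beta\cdot v=\gamma\cdot v\}$. A near-vector space over $F$ is an $F$-space $V$ whose action is free (if $\alpha\cdot v=\beta\cdot v$ then $v=0$ or $\alpha=\beta$) and such that $Q(V)$ generates $V$ as an additive group. For $v\in V\setminus\{0\}$, $\dim(v)$ is the minimum number of distinct elements of $Q(V)$ such that $v$ is the sum of those elements; $\dim(0)=0$.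 An $F$-subspace is a nonempty subset closed under addition and scalar multiplication. $\operatorname{Span}(S)$ is the intersection of all nonempty subsets of $V$ that contain $S$ and are closed under addition and scalar multiplication; $\operatorname{Span}(v)=\operatorname{Span}(\{v\})$. $F\cdot q=\{\alpha\cdot q\mid\alpha\in F\}$. For a family $\{S_i\}_{i\in I}$ of subsets of $V$, $\sum_{i\in I}S_i=\{\sum_{j\in J}s_j\mid J\subseteq I \text{ finite}, s_j\in S_j\}$; the sum is direct, written $\bigoplus_{i \in I} S_i$, if for every finite $J\subseteq I$ and $s_j,s_j'\in S_j$ ($j\in J$), $\sum_{j\in J}s_j=\sum_{j\in J}s_j'$ implies $s_j=s_j'$ for all $j\in J$. *)

(* Defs.v *)
From HB Require Import structures.
From mathcomp Require Import all_boot all_algebra finmap.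
From mathcomp Require Import boolp classical_sets.

Set Implicit Arguments.
Unset Strict Implicit.
Unset Printing Implicit Defensive.

Import GRing.Theory.
Local Open Scope classical_set_scope.
Local Open Scope ring_scope.

Reserved Notation "a **: v" (at level 40, left associativity).

(* The fields [sg_neq0_*] and [sg_inv_ex] say that F \ {0} is a group under the
   monoid operation of F.  The case -1 = 1 is allowed. *)
HB.mixin Record Monoid_isScalarGroup F of Monoid F := {
  sg0 : F;
  sgN1 : F;
  sg_mul0 : forall a : F, (sg0 * a)%g = sg0;
  sg_mulr0 : forall a : F, (a * sg0)%g = sg0;
  sg_sqr1 : forall x : F, (x * x)%g = 1%g <-> x = 1%g \/ x = sgN1;
  sg_neq0_one : (1%g : F) <> sg0;
  sg_neq0_mul : forall a b : F, a <> sg0 -> b <> sg0 -> (a * b)%g <> sg0;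
  sg_inv_ex : forall a : F, a <> sg0 ->
    exists b : F, [/\ b <> sg0, (a * b)%g = 1%g & (b * a)%g = 1%g]
}.

#[short(type="scalarGroupType")]
HB.structure Definition ScalarGroup :=
  {F of Monoid_isScalarGroup F & Monoid F}.

HB.mixin Record Zmodule_isFSpace (F : scalarGroupType) V of GRing.Zmodule V := {
  act : F -> V -> V;
  actA : forall (a b : F) (v : V), act a (act b v) = act (a * b)%g v;
  act1 : forall v : V, act 1%g v = v;
  actD : forall (a : F) (v w : V), act a (v + w) = act a v + act a w;
  actN1 : forall v : V, act sgN1 v = - v;
  act0 : forall v : V, act sg0 v = 0
}.

#[short(type="fSpaceType")]
HB.structure Definition FSpace (F : scalarGroupType) :=
  {V of Zmodule_isFSpace F V & GRing.Zmodule V}.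

Notation "a **: v" := (act a v) : ring_scope.

Definition quasi_kernel (F : scalarGroupType) (V : fSpaceType F) : set V :=
  [set v | forall a b : F, exists c : F, a **: v + b **: v = c **: v].
Arguments quasi_kernel {F} V.

Definition additive_subgroup (V : zmodType) (A : set V) : Prop :=
  A 0 /\ forall x y, A x -> A y -> A (x - y).

HB.mixin Record FSpace_isNearVectorSpace (F : scalarGroupType) V
    of FSpace F V := {
  act_free : forall (a b : F) (v : V), a **: v = b **: v -> v = 0 \/ a = b;
  quasi_kernel_gen :
    smallest (@additive_subgroup _) (quasi_kernel _ : set V) = [set: V]
}.

#[short(type="nearVectorSpaceType")]
HB.structure Definition NearVectorSpace (F : scalarGroupType) :=
  {V of FSpace_isNearVectorSpace F V & FSpace F V}.

Definition Fsubspace (F : scalarGroupType) (V : fSpaceType F) (W : set V) : Prop :=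
  [/\ W !=set0,
      (forall x y, W x -> W y -> W (x + y)) &
      (forall (a : F) x, W x -> W (a **: x))].

Definition Span (F : scalarGroupType) (V : fSpaceType F) (S : set V) : set V :=
  smallest (@Fsubspace F V) S.

Definition Fline (F : scalarGroupType) (V : fSpaceType F) (q : V) : set V :=
  [set a **: q | a in [set: F]].

(* The families of subsets below are indexed by a subset [D] of a type [I]. *)
Definition family_sum (V : zmodType) (I : choiceType) (D : set I)
    (S : I -> set V) : set V :=
  [set x | exists (J : {fset I}) (s : I -> V),
    [/\ [set` J] `<=` D, (forall j, j \in J -> S j (s j)) &
        x = \sum_(j <- J) s j]].

Definition family_direct (V : zmodType) (I : choiceType) (D : set I)
    (S : I -> set V) : Prop :=
  forall (J : {fset I}) (s s' : I -> V), [set` J] `<=` D ->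
    (forall j, j \in J -> S j (s j)) -> (forall j, j \in J -> S j (s' j)) ->
    \sum_(j <- J) s j = \sum_(j <- J) s' j ->
    forall j, j \in J -> s j = s' j.

Definition is_direct_sum (V : zmodType) (I : choiceType) (D : set I)
    (S : I -> set V) (W : set V) : Prop :=
  family_direct D S /\ W = family_sum D S.

Definition quasi_sum_size (F : scalarGroupType) (V : fSpaceType F) (v : V)
    (n : nat) : Prop :=
  exists Theta : {fset V},
    [/\ [set` Theta] `<=` quasi_kernel V, #|` Theta| = n
      & v = \sum_(q <- Theta) q].

Lemma quasi_kernel_act (F : scalarGroupType) (V : fSpaceType F) (c : F) (q : V) :
  quasi_kernel V q -> quasi_kernel V (c **: q).
Proof.
move=> Qq a b; have [->|/eqP c0] := eqVneq c sg0.
  by exists sg0; rewrite !actA !sg_mulr0 !act0 addr0.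
have [d] := Qq (a * c)%g (b * c)%g; rewrite !actA => ->.
by have [e [_ _ ec]] := sg_inv_ex _ c0; exists (d * e)%g; rewrite actA -mulgA ec mulg1.
Qed.

Lemma quasi_sum_size_ex (F : scalarGroupType) (V : nearVectorSpaceType F)
  (v : V) : exists n, `[< quasi_sum_size v n >].
Proof.
pose P n := `[< exists s : seq V, [/\ {in s, forall q, quasi_kernel V q},
                  size s = n & v = \sum_(q <- s) q] >].
have exP : exists n, P n.
  pose A : set V := [set x | exists s : seq V,
    {in s, forall q, quasi_kernel V q} /\ x = \sum_(q <- s) q].
  suff [s [sQ vE]] : A v by exists (size s); apply/asboolP; exists s.
  have : [set: V] v by [].
  rewrite -quasi_kernel_gen; apply; split; last first.
    move=> q Qq; exists [:: q]; rewrite big_seq1; split=> // x.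
    by rewrite inE => /eqP ->.
  split; first by exists [::]; rewrite big_nil.
  move=> _ _ [s [sQ ->]] [t [tQ ->]].
  exists (s ++ map (act sgN1) t); split.
    move=> x; rewrite mem_cat => /orP[/sQ//|/mapP[y /tQ Qy ->]].
    exact: quasi_kernel_act.
  rewrite big_cat big_map /= -sumrN; congr (_ + _).
  by apply: eq_bigr => y _; rewrite actN1.
have [n /asboolP[s [sQ sz vE]] nmin] := ex_minnP exP.
have us : uniq s.
  apply/contraT => /(uniqPn 0) [i [j [ij js e]]].
  have q_s : s`_i \in s by rewrite mem_nth // (ltn_trans ij).
  set q := s`_i in q_s e.
  have q_t : q \in rem q s.
    apply/contraT => nq.
    have it : (i < size (take j s))%N by rewrite size_takel // ltnW.
    have q_tk : q \in take j s by rewrite /q -(nth_take 0 ij) mem_nth.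
    have : (1 < count_mem q s)%N.
      rewrite -[s in count_mem q s](cat_take_drop j) count_cat (drop_nth 0 js) /=.
      by rewrite -e eqxx add1n addnS ltnS addn_gt0 -has_count has_pred1 q_tk.
    by rewrite (permP (perm_to_rem q_s)) /= eqxx (count_memPn nq).
  have p1 := perm_to_rem q_s; have p2 := perm_to_rem q_t.
  set t := rem q (rem q s) in p2.
  have ps : perm_eq s [:: q, q & t] by rewrite (perm_trans p1) // perm_cons.
  have Qq := sQ _ q_s.
  have [c] := Qq 1%g 1%g; rewrite !act1 => qq.
  have : P (size t).+1.
    apply/asboolP; exists (c **: q :: t); split=> //.
      move=> x; rewrite inE => /predU1P[->|xt]; first exact: quasi_kernel_act.
      by apply: sQ; rewrite (perm_mem ps) !inE xt !orbT.
    by rewrite vE (perm_big _ ps) /= !big_cons addrA qq.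
  by move/nmin; rewrite -sz (perm_size ps) /= ltnn.
have pE : perm_eq [fset x in s]%fset s.
  apply: uniq_perm => //.
  by move=> x; rewrite inE.
exists n; apply/asboolP; exists [fset x in s]%fset; split.
- by move=> x /=; rewrite inE => /sQ.
- by rewrite (perm_size pE).
- by rewrite (perm_big _ pE).
Qed.

(* The clause dim(0) = 0 is subsumed: the empty sum gives the minimum 0. *)
Definition nvdim (F : scalarGroupType) (V : nearVectorSpaceType F) (v : V) : nat :=
  ex_minn (quasi_sum_size_ex v).

(* Main.v *)
(* Any nonzero element w of Span(v), with v = q_1 + ... + q_n, that is a combination of
   the q_i with the fewest nonzero coefficients lies in Q(V): choosing c so that
   a w + b w - c w has one coefficient fewer forces a w + b w = c w.  Exchanging some q_i
   against a multiple x w of w leaves v - x w a sum of n - 1 quasi-kernel elements, so by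
   induction v is a sum of at most n quasi-kernel elements of Span(v).  For n = dim(v) this
   is a minimal decomposition, and the same exchange (with w = 0) makes it independent. *)

Require Import Defs.
From HB Require Import structures.
From mathcomp Require Import all_boot all_algebra finmap.
From mathcomp Require Import boolp classical_sets.
From mathcomp Require Import zify.

Set Implicit Arguments.
Unset Strict Implicit.
Unset Printing Implicit Defensive.

Import GRing.Theory.
Local Open Scope classical_set_scope.
Local Open Scope ring_scope.

(** * Subspaces, spans and quasi-kernel sums *)

Section FSpaceTheory.
Context {F : scalarGroupType} {V : fSpaceType F}.
Implicit Types (W S : set V) (u v : V).

Lemma act_zero a : a **: (0 : V) = 0.
Proof. by rewrite -(act0 (0 : V)) actA sg_mulr0. Qed.

Lemma act_sum a (I : Type) (r : seq I) (f : I -> V) :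
  a **: (\sum_(i <- r) f i) = \sum_(i <- r) a **: f i.
Proof. by elim/big_rec2: _ => [|i x y _ <-]; rewrite ?act_zero ?actD. Qed.

Lemma Fsubspace0 W : Fsubspace W -> W 0.
Proof. by case=> -[x Wx] _ /(_ sg0 x Wx); rewrite act0. Qed.

Lemma FsubspaceB W u v : Fsubspace W -> W u -> W v -> W (u - v).
Proof. by case=> _ WD WZ Wu Wv; rewrite -actN1; apply/WD/WZ. Qed.

Lemma Fsubspace_sum W (I : eqType) (r : seq I) (f : I -> V) :
  Fsubspace W -> {in r, forall i, W (f i)} -> W (\sum_(i <- r) f i).
Proof.
move=> sW Wf; rewrite big_seq; elim/big_ind: _ => //; first exact: Fsubspace0.
by case: sW.
Qed.

Lemma Span_Fsubspace S : Fsubspace (Span S).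
Proof.
split.
- by exists 0; move=> W [sW _]; exact: Fsubspace0.
- by move=> x y Sx Sy W sSW; case: (sSW) => -[_ WD _] _; apply: WD; [exact: Sx|exact: Sy].
- by move=> a x Sx W sSW; case: (sSW) => -[_ _ WZ] _; apply: WZ; exact: Sx.
Qed.

Lemma sub_Span S : S `<=` Span S.
Proof. exact: sub_smallest. Qed.

Lemma Span_sub W S : Fsubspace W -> S `<=` W -> Span S `<=` W.
Proof. by move=> sW SW; exact: smallest_sub. Qed.

Section Combinations.
Context {I : eqType} (r : seq I) (q : I -> V).
Hypothesis Qq : {in r, forall i, quasi_kernel V (q i)}.

(** [F] has no addition, so coefficients cannot simply be added. The quasi-kernel condition supplies
    a coefficient for each [i] separately, depending on [q i]. *)
Lemma line_add (a b : I -> F) : exists c : I -> F,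
  {in r, forall i, a i **: q i + b i **: q i = c i **: q i}.
Proof.
suff /choice [c cE] : forall i, exists c, i \in r ->
    a i **: q i + b i **: q i = c **: q i by exists c.
move=> i; have [ir|_] := boolP (i \in r); last by exists sg0.
by have [c cE] := Qq ir (a i) (b i); exists c.
Qed.

(** With [x] the inverse of [a i0], the [i0] terms on both sides agree. For every other [i],
    subtracting [(x * a i) **: q i] from [q i] stays on the line of [q i], which gives [b i]. *)
Lemma exchange (a : I -> F) (i0 : I) : uniq r -> i0 \in r -> a i0 != sg0 ->
  exists (x : F) (b : I -> F), \sum_(i <- r) q i =
    x **: (\sum_(i <- r) a i **: q i) + \sum_(i <- rem i0 r) b i **: q i.
Proof.
move=> ur i0r /eqP a0; have [x [_ _ xa]] := sg_inv_ex _ a0.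
have [b bE] := line_add (fun=> 1%g) (fun i => sgN1 * (x * a i))%g.
exists x, b; rewrite !(perm_big _ (perm_to_rem i0r)) /= !big_cons.
rewrite actD actA xa act1 -addrA act_sum -big_split; congr (_ + _).
apply: eq_big_seq => i /mem_rem /bE <-.
by rewrite act1 -actA actN1 actA /= addrC subrK.
Qed.

End Combinations.

(* The duplicates of [s] are merged using [q + q = c **: q]. *)
Lemma fset_of_quasi_sum W (s : seq V) : Fsubspace W ->
    {in s, forall x, quasi_kernel V x /\ W x} ->
  exists T : {fset V}, [/\ {in T, forall x, quasi_kernel V x /\ W x},
    (#|` T| <= size s)%N & \sum_(x <- s) x = \sum_(x <- T) x].
Proof.
move=> sW; have [n] := ubnP (size s); elim: n s => // n IHn s sn Ps.
have [us|/uniqPn nus] := boolP (uniq s).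
  have pE : perm_eq [fset x in s]%fset s.
    by apply: uniq_perm => // x; rewrite inE.
  exists [fset x in s]%fset; split; first by move=> x; rewrite inE; apply: Ps.
    by rewrite (perm_size pE).
  by rewrite (perm_big _ pE).
have [q [t pst]] : exists q t, perm_eq s [:: q, q & t].
  have [i [j [ij js e]]] := nus 0.
  (* [t] is [s] without its two equal entries at positions [i < j]. *)
  exists s`_i, (take i s ++ drop i.+1 (take j s) ++ drop j.+1 s).
  have sE : s = take i s ++ s`_i :: drop i.+1 (take j s) ++ s`_i :: drop j.+1 s.
    rewrite -{1}[s](cat_take_drop j) (drop_nth 0 js) -e.
    rewrite -{1}[take j s](cat_take_drop i) take_takel 1?ltnW //.
    have it : (i < size (take j s))%N by rewrite size_takel // ltnW.
    by rewrite (drop_nth 0 it) nth_take // -catA.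
  by rewrite {1}sE; apply/permP => p; rewrite /= !count_cat /= !count_cat /=; lia.
have [Qq Wq] : quasi_kernel V q /\ W q.
  by apply: Ps; rewrite (perm_mem pst) mem_head.
have [c] := Qq 1%g 1%g; rewrite !act1 => qq.
have st : size s = (size t).+2 by rewrite (perm_size pst).
have [||T [PT Ts TE]] := IHn (c **: q :: t).
- by rewrite st in sn.
- move=> x; rewrite inE => /predU1P[->|xt].
    by split; [exact: quasi_kernel_act|case: sW => _ _; apply].
  by apply: Ps; rewrite (perm_mem pst) !inE xt !orbT.
exists T; split=> //; first by rewrite st ltnW.
by rewrite -TE (perm_big _ pst) /= !big_cons addrA qq.
Qed.

(** The nonzero coefficient at [i0] is what later lets [exchange] remove [q i0]. *)
Lemma quasi_kernel_in_Fsubspace W (I : eqType) (r : seq I) (q : I -> V) :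
    uniq r -> {in r, forall i, quasi_kernel V (q i)} ->
    Fsubspace W -> W (\sum_(i <- r) q i) -> \sum_(i <- r) q i != 0 ->
  exists (a : I -> F) (i0 : I), [/\ i0 \in r, a i0 != sg0,
    W (\sum_(i <- r) a i **: q i) & quasi_kernel V (\sum_(i <- r) a i **: q i)].
Proof.
move=> ur Qq sW Wv v0.
pose supp (a : I -> F) := count (fun i => a i != sg0) r.
pose P n := `[< exists a, [/\ supp a = n, W (\sum_(i <- r) a i **: q i)
                  & \sum_(i <- r) a i **: q i != 0] >].
have exP : exists n, P n.
  exists (supp (fun=> 1%g)); apply/asboolP; exists (fun=> 1%g).
  by under eq_bigr do rewrite act1.
have [n /asboolP[a [sa Wa a0]] nmin] := ex_minnP exP.
have /hasP [i0 i0r ai0] : has (fun i => a i != sg0) r.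
  apply: contraNT a0 => /hasPn na; apply/eqP/big1_seq => i /andP[_ /na].
  by rewrite negbK => /eqP ->; rewrite act0.
exists a, i0; split=> // x y; set w := \sum_(i <- r) _.
(* [c] is the [i0] coefficient of [x **: w + y **: w]. With [e] the inverse of [a i0], the vector
   [(c * e) **: w] has the same [i0] term. *)
have [c cE] := Qq _ i0r (x * a i0)%g (y * a i0)%g.
have /eqP ai0' := ai0; have [e [_ _ ea]] := sg_inv_ex _ ai0'.
exists (c * e)%g.
have [b bE] := line_add Qq (fun i => x * a i)%g (fun i => y * a i)%g.
have [d dE] := line_add Qq b (fun i => sgN1 * (c * e * a i))%g.
(* [d i] may be nonzero although [d i **: q i] vanishes, as when [q i = 0]. Resetting it to zero at
   [i0] and off the support of [a] makes the support strictly smaller. *)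
pose d' i := if (a i == sg0) || (i == i0) then sg0 else d i.
have wE : x **: w + y **: w - (c * e)%g **: w = \sum_(i <- r) d' i **: q i.
  rewrite !act_sum -sumrN -!big_split; apply: eq_big_seq => i ir /=.
  rewrite !actA -actN1 actA bE // dE // /d'.
  case: eqVneq => [a_0|_] /=; last case: eqVneq => [ii0|//].
    by rewrite -dE // -bE // a_0 !sg_mulr0 !act0 !addr0.
  by rewrite -dE // -bE // ii0 cE -mulgA ea mulg1 -actA actN1 subrr act0.
apply/eqP; rewrite -subr_eq0; apply/contraT; rewrite wE => d0.
have : P (supp d').
  apply/asboolP; exists d'; split=> //; rewrite -wE.
  by case: (sW) => _ WD WZ; apply: FsubspaceB => //; [apply: WD|]; apply: WZ.
move/nmin; rewrite -sa leqNgt => /negP[].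
rewrite /supp !(permP (perm_to_rem i0r)) /= ai0 {1}/d' eqxx orbT /= eqxx add0n add1n ltnS.
by apply: sub_count => i /=; rewrite /d'; case: (a i == sg0) => //=; rewrite eqxx.
Qed.

(** The sum is over an indexed family, not a set, because the vectors [b i **: q i] left by an
    exchange may coincide or vanish. *)
Lemma quasi_sum_in_Span (I : eqType) (r : seq I) (q : I -> V) :
    uniq r -> {in r, forall i, quasi_kernel V (q i)} ->
  exists s : seq V, [/\ {in s, forall x, quasi_kernel V x /\
      Span [set \sum_(i <- r) q i] x},
    (size s <= size r)%N & \sum_(i <- r) q i = \sum_(x <- s) x].
Proof.
have [n] := ubnP (size r); elim: n r q => // n IHn r q rn ur Qq.
set v := \sum_(i <- r) _.
have [v0|v0] := eqVneq v 0; first by exists [::]; rewrite v0 big_nil.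
have sW := Span_Fsubspace [set v]; have Wv : Span [set v] v by exact: sub_Span.
have [a [i0 [i0r ai0 Ww Qw]]] := quasi_kernel_in_Fsubspace ur Qq sW Wv v0.
have [x [b]] := exchange Qq ur i0r ai0.
rewrite -/v; set w := \sum_(i <- r) _ in Ww Qw *; set v' := \sum_(i <- _) _ => vE.
have Wxw : Span [set v] (x **: w) by case: sW => _ _; apply.
have sr := perm_size (perm_to_rem i0r).
have [|||s [Ps ss sE]] := IHn (rem i0 r) (fun i => b i **: q i).
- by rewrite sr in rn.
- exact: rem_uniq.
- by move=> i /mem_rem /Qq; exact: quasi_kernel_act.
exists (x **: w :: s); rewrite sr big_cons -sE; split=> //.
move=> y; rewrite inE => /predU1P[->|/Ps[Qy Sy]].
  by split=> //; exact: quasi_kernel_act.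
(* The induction places [y] in the span of [v - x **: w], which lies inside the span of [v]. *)
split=> //; refine (Span_sub sW _ Sy) => _ ->.
have -> : \sum_(i <- rem i0 r) b i **: q i = v - x **: w by rewrite vE addrC addKr.
exact: FsubspaceB sW Wv Wxw.
Qed.

(** * Spans of finite subsets of the quasi-kernel *)

Lemma family_sum_FlineP (T : {fset V}) u :
  family_sum [set` T] (fun q : V => Fline q) u <->
  exists a : V -> F, u = \sum_(q <- T) a q **: q.
Proof.
split=> [[J [s [JT sJ ->]]]|[a ->]]; last first.
  by exists T, (fun q => a q **: q); split=> // q _; exists (a q).
(* A sum over [J] becomes a sum over [T] by padding with zeros. *)
have /choice [a aE] : forall q, exists c : F, (if q \in J then s q else 0) = c **: q.
  move=> q; case: ifP => [/sJ [c _ <-]|_]; first by exists c.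
  by exists sg0; rewrite act0.
exists a; under [RHS]eq_bigr do rewrite -aE.
have JT' : (J `<=` T)%fset by apply/fsubsetP => q /JT.
rewrite -(big_fset_incl _ JT') => [|q _ /negPf ->//].
by apply: eq_big_seq => q ->.
Qed.

Lemma Span_fset (T : {fset V}) : [set` T] `<=` quasi_kernel V ->
  Span [set` T] = family_sum [set` T] (fun q : V => Fline q).
Proof.
move=> QT; apply/seteqP; split=> [|u /family_sum_FlineP [a ->]]; last first.
  have sW := Span_Fsubspace [set` T]; apply: Fsubspace_sum => // q qT.
  by case: (sW) => _ _; apply; exact: sub_Span.
apply: Span_sub; first split.
- by exists 0; apply/family_sum_FlineP; exists (fun=> sg0); rewrite big1 // => i _; rewrite act0.
- move=> _ _ /family_sum_FlineP [a ->] /family_sum_FlineP [b ->].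
  have [c cE] := @line_add _ T id QT a b.
  apply/family_sum_FlineP; exists c; rewrite -big_split.
  exact: eq_big_seq.
- move=> c _ /family_sum_FlineP [a ->]; apply/family_sum_FlineP.
  by exists (fun q => c * a q)%g; rewrite act_sum; under eq_bigr do rewrite actA.
move=> q /= qT; exists [fset q]%fset, id; split.
- by move=> x /=; rewrite inE => /eqP ->.
- by move=> x _; exists 1%g; rewrite ?act1.
- by rewrite big_seq_fset1.
Qed.

End FSpaceTheory.

(** * Dimension and directness *)

Section NearVectorSpaceTheory.
Context {F : scalarGroupType} {V : nearVectorSpaceType F}.

(** [nvdim] is a minimum over sets, so repeated entries of [s] are merged first. *)
Lemma nvdim_le (s : seq V) : {in s, forall x, quasi_kernel V x} ->
  (nvdim (\sum_(x <- s) x)%R <= size s)%N.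
Proof.
move=> Qs; have sT : Fsubspace [set: V] by split=> //; exists 0.
have [|T [PT Ts TE]] := fset_of_quasi_sum sT (s := s); first by move=> x /Qs.
rewrite /nvdim; case: ex_minnP => m _ mmin; apply: leq_trans Ts; apply: mmin.
by apply/asboolP; exists T; split=> // x /PT[].
Qed.

(** Two different expressions would give a relation among the elements of [T] with a nonzero
    coefficient at [j]. Exchanging against it writes the sum with one term fewer. *)
Lemma minimal_family_direct (T : {fset V}) : [set` T] `<=` quasi_kernel V ->
    #|` T| = nvdim (\sum_(q <- T) q) ->
  family_direct [set` T] (fun q : V => Fline q).
Proof.
move=> QT Tdim J s s' JT sJ s'J ss' j jJ; apply: contrapT => nss'.
have QT' : {in T, forall q, quasi_kernel V (id q)} by exact: QT.
have /choice [a aE] : forall q, exists c : F,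
    (if q \in J then s q - s' q else 0) = c **: q.
  move=> q; case: ifP => [qJ|_]; last by exists sg0; rewrite act0.
  have [[b _ <-] [b' _ <-]] := (sJ _ qJ, s'J _ qJ).
  have [c cE] := QT _ (JT _ qJ) b (sgN1 * b')%g.
  by exists c; rewrite -cE -actA actN1.
have jT : j \in T by exact: JT.
have aj : a j != sg0.
  apply: contra_notN nss' => /eqP aj0; apply/eqP; rewrite -subr_eq0.
  by have := aE j; rewrite jJ aj0 act0 => ->.
have [x [b]] := exchange QT' (fset_uniq T) jT aj.
have -> : \sum_(q <- T) a q **: q = 0.
  under eq_bigr do rewrite -aE.
  have JT' : (J `<=` T)%fset by apply/fsubsetP => q /JT.
  rewrite -(big_fset_incl _ JT') => [|q _ /negPf ->//].
  under eq_big_seq => q -> do over.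
  by rewrite sumrB ss' subrr.
rewrite act_zero add0r => TE.
have := @nvdim_le [seq b q **: q | q <- rem j T].
rewrite big_map -TE -Tdim size_map size_rem //.
(* The shortened list has size [#|T|.-1], which is smaller than [#|T|] because [j] lies in [T]. *)
rewrite leqNgt prednK ?leqnn; last by rewrite -has_predT; apply/hasP; exists j.
suff H : {in [seq b q **: q | q <- rem j T], forall x : V, quasi_kernel V x} by move=> /(_ H).
by move=> _ /mapP [q /mem_rem /QT Qq ->]; exact: quasi_kernel_act.
Qed.

End NearVectorSpaceTheory.

Theorem theorem3p2 (F : scalarGroupType) (V : nearVectorSpaceType F) (v : V)
    (hv : v != 0) :
  exists Theta : {fset V},
    [/\ [set` Theta] `<=` quasi_kernel V,
        #|` Theta| = nvdim v,
        v = \sum_(q <- Theta) q,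
        Span [set v] = Span [set` Theta]
      & is_direct_sum [set` Theta] (fun q : V => Fline q) (Span [set` Theta])].
Proof.
have [Th [QTh dTh vE]] : quasi_sum_size v (nvdim v).
  by rewrite /nvdim; case: ex_minnP => m /asboolP.
(* A minimal decomposition is replaced by one inside [Span [set v]] with no more terms; minimality
   then forces its size to be [nvdim v]. *)
have [s [Ps ss sE]] := quasi_sum_in_Span (q := id) (fset_uniq Th) QTh.
rewrite -vE in Ps sE.
have [T [PT Ts TE]] := fset_of_quasi_sum (Span_Fsubspace _) Ps.
have QT : [set` T] `<=` quasi_kernel V by move=> x /PT[].
have vT : v = \sum_(q <- T) q by rewrite -TE.
have dT : #|` T| = nvdim v.
  apply/eqP; rewrite eqn_leq -{1}dTh (leq_trans Ts ss) /=.
  by rewrite [X in nvdim X]vT; apply: nvdim_le.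
exists T; split=> //.
  apply/seteqP; split; apply: Span_sub; try exact: Span_Fsubspace.
    move=> _ ->; rewrite vT; apply: Fsubspace_sum; first exact: Span_Fsubspace.
    by move=> q qT; exact: sub_Span.
  by move=> q /PT[].
split; last exact: Span_fset.
by apply: minimal_family_direct => //; rewrite -vT.
Qed.
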